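(* Let $p$ be an odd prime and let $\mu=\max\{v_2(p-1), v_2(p+1)\}$. Let $T_2$ be the Chebyshev polynomial of degree $2$. Then for every integer $\nu\ge 0$, $$\lim_{\substack{n \to \infty\\ v_2(n)=\nu}}\frac{\#\operatorname{Per}\left(T_2, \mathbb{F}_{p^n}\right)}{p^n}=\frac{2^{\mu+\nu-1}+1}{2^{\mu+\nu+1}}.$$
   Context: For a polynomial $\phi$ with integer coefficients (reduced mod $p$) and a field $K$ of characteristic $p$, $\operatorname{Per}(\phi,K)=\{\alpha\in K : \phi^m(\alpha)=\alpha \text{ for some } m>0\}$, where $\phi^m$ is the $m$-th iterate of $\phi$ under composition. $\mathbb{F}_{p^n}$ is the field with $p^n$ elements. $v_2$ is the $2$-adic valuation. The Chebyshev polynomials $T_d\in\mathbb{Z}[w]$ are defined by $T_0(w)=2$, $T_1(w)=w$, $T_d(w)=wT_{d-1}(w)-T_{d-2}(w)$ for $d\ge 2$ (equivalently $T_d(z+z^{-1})=z^d+z^{-d}$); in particular $T_2(w)=w^2-2$. The limit is taken as $n\to\infty$ through the positive integers $n$ with $v_2(n)=\nu$. *)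

(* Defs.v *)
From HB Require Import structures.
From mathcomp Require Import all_boot all_order all_algebra.
From mathcomp Require Import all_classical all_reals all_analysis.
Set Implicit Arguments.
Unset Strict Implicit.
Unset Printing Implicit Defensive.
Import Order.TTheory GRing.Theory Num.Theory.
Import numFieldNormedType.Exports.
Local Open Scope classical_set_scope.
Local Open Scope ring_scope.

(* Dickson normalization, T_d(z + 1/z) = z^d + 1/z^d: here T_0 = 2, not 1. *)
Fixpoint chebyshev_poly (d : nat) : {poly int} :=
  match d with
  | 0%N => 2%:P
  | d1.+1 => match d1 with
             | 0%N => 'X
             | d2.+1 => 'X * chebyshev_poly d1 - chebyshev_poly d2
             end
  end.

Definition poly_iter (m : nat) (phi : {poly int}) : {poly int} :=
  iter m (fun q => phi \Po q) 'X.

(* Mapping coefficients along the canonical morphism int -> K is the reduction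
   mod p when K has characteristic p. *)
Definition Per (phi : {poly int}) (K : fieldType) : set K :=
  [set a : K | exists m : nat,
     (0 < m)%N /\ (map_poly (intr : int -> K) (poly_iter m phi)).[a] = a].
Arguments Per : clear implicits.

(* Main.v *)
(* Every w in F_q, q = p^n, is z + 1/z for some z in an algebraic closure with
   z^(q-1) = 1 or z^(q+1) = 1, and T_2 acts as z |-> z^2; hence w is periodic
   iff z has odd order, i.e. z^a = 1 or z^b = 1 where a and b are the odd parts
   of q-1 and q+1.  Listing the a + b solutions with z = 1 occurring twice, each
   periodic w is hit exactly twice, so 2 #Per = a + b.  One of v_2(q-1), v_2(q+1)
   is 1 and the other is mu + nu, so #Per / q is within 1/q of the limit. *)
Require Import Defs.
From HB Require Import structures.
From mathcomp Require Import all_boot all_order all_algebra all_field.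
From mathcomp Require Import all_classical all_reals all_analysis.
From mathcomp Require Import zify ring lra.
Import Order.TTheory GRing.Theory Num.Theory.
Import numFieldNormedType.Exports.
Local Open Scope classical_set_scope.
Local Open Scope ring_scope.

Set Implicit Arguments.
Unset Strict Implicit.
Unset Printing Implicit Defensive.

(** * Roots of unity and the double cover z -> z + 1/z *)

Lemma roots_of_unity_seq (L : closedFieldType) (n : nat) :
  n%:R != 0 :> L ->
  exists s : seq L,
    [/\ uniq s, size s = n & forall z, (z \in s) = (z ^+ n == 1)].
Proof.
move=> n0; have n_gt0 : (0 < n)%N.
  by rewrite lt0n; apply: contraNneq n0 => ->.
have [r def_r] := closed_field_poly_normal ('X^n - 1 : {poly L}).
move: def_r; rewrite lead_coefXnsubC // scale1r => def_r.
exists r; split.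
- by rewrite -separable_prod_XsubC -def_r separable_Xn_sub_1.
- by apply: succn_inj; rewrite -(size_prod_XsubC r id) -def_r size_XnsubC.
- by move=> z; rewrite -root_prod_XsubC -def_r rootE !hornerE subr_eq0.
Qed.

Lemma addrV_eq (L : fieldType) (z y : L) : z != 0 -> y != 0 ->
  (y + y^-1 == z + z^-1) = (y == z) || (y == z^-1).
Proof.
move=> z0 y0; rewrite -subr_eq0.
have -> : y + y^-1 - (z + z^-1) = (y - z) * (y - z^-1) / y.
  by field; rewrite z0 y0.
by rewrite mulf_eq0 invr_eq0 (negbTE y0) orbF mulf_eq0 !subr_eq0.
Qed.

Lemma chebyshev2_iter_addrV (L : fieldType) (z : L) (m : nat) : z != 0 ->
  (map_poly intr (poly_iter m (chebyshev_poly 2))).[z + z^-1]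
  = z ^+ (2 ^ m) + z ^- (2 ^ m).
Proof.
move=> z0; elim: m => [|m IHm]; first by rewrite /poly_iter /= map_polyX hornerX.
rewrite [poly_iter _ _]/(chebyshev_poly 2 \Po poly_iter m _) map_comp_poly.
rewrite horner_comp IHm expnSr exprM /chebyshev_poly.
rewrite rmorphB rmorphM /= map_polyX map_polyC /= !hornerE.
have zm0 : z ^+ (2 ^ m) != 0 by rewrite expf_neq0.
by field.
Qed.

Lemma expr_eq1_neq0 (L : fieldType) (z : L) (n : nat) :
  (0 < n)%N -> z ^+ n = 1 -> z != 0.
Proof.
move=> n_gt0; apply: contra_eq_neq => ->.
by rewrite expr0n -leqn0 leqNgt n_gt0 eq_sym oner_eq0.
Qed.

(** From z^2 = 1 and n odd, z = z^n. Hence among the z of odd order the fibre {z, 1/z} collapses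
    only at 1. *)
Lemma odd_expr_eq1_invr_eq1 (L : fieldType) (z : L) (n : nat) :
  odd n -> z ^+ n = 1 -> z = z^-1 -> z = 1.
Proof.
move=> n_odd zn1 z_inv.
have z0 : z != 0 := expr_eq1_neq0 (odd_gt0 n_odd) zn1.
have z2 : z ^+ 2 = 1 by rewrite expr2 {2}z_inv divff.
by rewrite -zn1 -(odd_double_half n) n_odd -mul2n exprS exprM z2 expr1n mulr1.
Qed.

(** * Odd parts and elements of odd order *)

Lemma dvdn_odd_part (m n : nat) : (0 < n)%N -> odd m -> (m %| n)%N ->
  (m %| n`_2^')%N.
Proof.
move=> n0 m_odd; rewrite -{1}(partnC 2%N n0) Gauss_dvdr //.
by rewrite p_part coprimeXr // coprime_sym coprime2n.
Qed.

Lemma odd_part_odd (n : nat) : odd (n`_2^')%N.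
Proof. by rewrite odd_2'nat part_pnat. Qed.

(** The order of z divides e, so it is odd; it also divides n, hence the odd part of n. *)
Lemma expr_odd_part_eq1 (L : fieldType) (z : L) (e n : nat) :
  (0 < n)%N -> odd e -> z ^+ e = 1 -> z ^+ n = 1 -> z ^+ (n`_2^')%N = 1.
Proof.
move=> n0 e_odd ze zn.
have [|m zm m_e] := prim_order_exists _ ze; first by case: e e_odd {ze}.
apply/eqP; rewrite -(prim_order_dvd zm) dvdn_odd_part //.
  exact: dvdn_odd e_odd.
by rewrite (prim_order_dvd zm) zn.
Qed.

(** * Descent to the finite field *)

Lemma expr_fixed_in_field (K : finFieldType) (L : fieldType)
  (iota : {rmorphism K -> L}) (x : L) :
  x ^+ #|K| = x -> exists w : K, iota w = x.
Proof.
(* Over K, X^q - X is the product of the X - w; it vanishes at x, so some factor does. *)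
move=> xq; have := congr1 (fun P => (map_poly iota P).[x]) (finField_genPoly K).
rewrite rmorphB /= map_polyXn map_polyX !hornerE xq subrr rmorph_prod /=.
rewrite horner_prod => /esym/eqP/prodf_eq0 [w _].
rewrite rmorphB /= map_polyX map_polyC !hornerE subr_eq0 => /eqP ->.
by exists w.
Qed.

Lemma expr_card_addrV (K : finFieldType) (L : fieldType)
  (iota : {rmorphism K -> L}) (p n : nat) (z : L) :
  prime p -> #|K| = (p ^ n)%N ->
  (z + z^-1) ^+ #|K| = z ^+ #|K| + z^-1 ^+ #|K|.
Proof.
move=> p_prime cardK; have pcharK := card_finPcharP cardK p_prime.
rewrite cardK; apply: exprDn_pchar; rewrite pnatX; apply/orP; left.
by rewrite pnatE // (fmorph_pchar iota).
Qed.

(** The image of K is the fixed set of the q-power map, which sends z + 1/z to z^q + 1/z^q; the two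
    agree iff z^q is z or 1/z. *)
Lemma addrV_in_field (K : finFieldType) (L : fieldType)
  (iota : {rmorphism K -> L}) (p n : nat) (z : L) :
  prime p -> #|K| = (p ^ n)%N -> z != 0 ->
  (exists w, iota w = z + z^-1) <->
  z ^+ (#|K| - 1) = 1 \/ z ^+ (#|K| + 1) = 1.
Proof.
move=> p_prime cardK z0; have q_gt0 : (0 < #|K|)%N by apply/card_gt0P; exists 0.
have zq_eq : (z + z^-1) ^+ #|K| = z + z^-1 <->
    z ^+ (#|K| - 1) = 1 \/ z ^+ (#|K| + 1) = 1.
  rewrite (expr_card_addrV iota z p_prime cardK) exprVn (rwP eqP).
  rewrite addrV_eq ?expf_neq0 //.
  have -> : (z ^+ #|K| == z) = (z ^+ (#|K| - 1) == 1).
    by rewrite -{1}(subnK q_gt0) addn1 exprS -subr_eq0 -[X in _ - X]mulr1 -mulrBr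
      mulf_eq0 (negbTE z0) /= subr_eq0.
  have -> : (z ^+ #|K| == z^-1) = (z ^+ (#|K| + 1) == 1).
    by rewrite addn1 exprSr -(inj_eq (mulIf z0)) mulVf.
  by split=> [/orP[]/eqP|[]->]; rewrite ?eqxx ?orbT; auto.
split=> [[w wz]|/zq_eq /(expr_fixed_in_field iota)//].
by apply/zq_eq; rewrite -wz -rmorphXn expf_card.
Qed.

Lemma exists_addrV_eq (L : closedFieldType) (x : L) :
  exists2 z : L, z != 0 & x = z + z^-1.
Proof.
(* The coefficients encode z^2 = x z - 1. *)
have [z] := @solve_monicpoly L 2 (fun i => if i == 0%N then -1 else x) isT.
rewrite !big_ord_recl big_ord0 /= expr0 expr1 mulr1 addr0 => zx.
have z0 : z != 0.
  apply: contra_eq_neq zx => ->.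
  by rewrite mulr0 addr0 expr0n /= eq_sym oppr_eq0 oner_eq0.
exists z => //; apply: (mulIf z0).
by rewrite mulrDl mulVf // -expr2 zx; ring.
Qed.

(** * Periodic points of T_2 *)

Lemma Per_chebyshev2P (K : finFieldType) (L : closedFieldType)
  (iota : {rmorphism K -> L}) (p n : nat) (w : K) :
  prime p -> #|K| = (p ^ n)%N ->
  w \in Per (chebyshev_poly 2) K <->
  exists z : L, iota w = z + z^-1 /\
    (z ^+ ((#|K| - 1)`_2^')%N = 1 \/ z ^+ ((#|K| + 1)`_2^')%N = 1).
Proof.
move=> p_prime cardK; rewrite in_setE.
have q_gt1 : (0 < #|K| - 1)%N by rewrite subn_gt0 finNzRing_gt1.
have q1_gt0 : (0 < #|K| + 1)%N by rewrite addn1.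
have iota_iter m : iota (map_poly intr (poly_iter m (chebyshev_poly 2))).[w]
    = (map_poly intr (poly_iter m (chebyshev_poly 2))).[iota w].
  by rewrite -horner_map -map_poly_comp; congr _.[_]; apply: eq_map_poly => i /=;
    rewrite rmorph_int.
split=> [[m [m_gt0 w_per]]|[z [wz z_odd]]].
  have [z z0 wz] := exists_addrV_eq (iota w).
  exists z; split=> //.
  have /eqP := iota_iter m; rewrite w_per wz chebyshev2_iter_addrV // eq_sym.
  rewrite addrV_eq ?expf_neq0 // => z_per.
  (* Here z^(2^m) is z or 1/z, so e is 2^m - 1 or 2^m + 1, odd because m > 0. *)
  have [e e_odd ze] : exists2 e, odd e & z ^+ e = 1.
    have m2_gt0 : (0 < 2 ^ m)%N by rewrite expn_gt0.
    have m2_odd : odd (2 ^ m) = false by rewrite oddX orbF -leqn0 leqNgt m_gt0.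
    case/orP: z_per => /eqP z_per.
      exists (2 ^ m - 1)%N; first by rewrite oddB // m2_odd.
      by apply: (mulIf z0); rewrite mul1r -exprSr subn1 prednK.
    exists (2 ^ m + 1)%N; first by rewrite oddD m2_odd.
    by rewrite addn1 exprSr z_per mulVf.
  have [zq|zq] := (addrV_in_field iota p_prime cardK z0).1 (ex_intro _ w wz).
    by left; apply: expr_odd_part_eq1 ze zq.
  by right; apply: expr_odd_part_eq1 ze zq.
have [e e_odd ze] : exists2 e, odd e & z ^+ e = 1.
  by case: z_odd => ze; eexists; try exact: ze; exact: odd_part_odd.
have z0 : z != 0 := expr_eq1_neq0 (odd_gt0 e_odd) ze.
(* By Euler's theorem 2^(totient e) is 1 mod e, so this many squarings fix z. *)
exists (totient e); split; first by rewrite totient_gt0; case: e e_odd {ze}.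
apply: (fmorph_inj iota); rewrite iota_iter wz chebyshev2_iter_addrV //.
suff -> : z ^+ (2 ^ totient e) = z by [].
have z_mod k : z ^+ (k %% e) = z ^+ k.
  by rewrite [in RHS](divn_eq k e) exprD mulnC exprM ze expr1n mul1r.
by rewrite -z_mod cyclic.Euler_exp_totient ?coprime2n // z_mod expr1.
Qed.

(** * Counting the fibres of z -> z + 1/z *)

Lemma count_addrV_eq (L : fieldType) (s : seq L) (N : nat) (z : L) :
  uniq s -> (forall y, (y \in s) = (y ^+ N == 1)) -> (0 < N)%N -> z != 0 ->
  z != z^-1 ->
  count (fun y => y + y^-1 == z + z^-1) s = (2 * (z ^+ N == 1)%R)%N.
Proof.
move=> s_uniq s_mem N_gt0 z0 zV.
have s0 y : y \in s -> y != 0.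
  by rewrite s_mem => /eqP; apply: expr_eq1_neq0.
rewrite (@eq_in_count _ _ (predU (pred1 z) (pred1 z^-1))) => [|y /s0 y0]; last first.
  by rewrite addrV_eq.
have := count_predUI (pred1 z) (pred1 z^-1) s.
(* The distinct points z and 1/z lie both in [s] or both outside it. *)
rewrite !count_uniq_mem // !s_mem exprVn invr_eq1 addnn mul2n => <-.
rewrite (@eq_count _ (predI _ _) pred0) ?count_pred0 ?addn0 // => y /=.
by apply: contraNF zV => /andP[/eqP<- /eqP<-].
Qed.

(** The fibre over 2 is the single point 1; the second hit will come from the other list of
    roots. *)
Lemma count_addrV_eq2 (L : fieldType) (s : seq L) (N : nat) :
  odd N ->
  uniq s -> (forall y, (y \in s) = (y ^+ N == 1)) ->
  count (fun y => y + y^-1 == 1 + 1^-1) s = 1%N.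
Proof.
move=> N_odd s_uniq s_mem.
have s0 y : y \in s -> y != 0.
  by rewrite s_mem => /eqP; apply: expr_eq1_neq0 (odd_gt0 N_odd).
rewrite (@eq_in_count _ _ (pred1 1)) => [|y /s0 y0].
  by rewrite count_uniq_mem // s_mem expr1n eqxx.
by rewrite addrV_eq ?oner_eq0 //= invr1 orbb.
Qed.

(** A common divisor is odd and divides (q + 1) - (q - 1) = 2. *)
Lemma coprime_odd_part_pred_succ (q : nat) : (1 < q)%N ->
  coprime ((q - 1)`_2^')%N ((q + 1)`_2^')%N.
Proof.
move=> q_gt1; set g := gcdn ((q - 1)`_2^')%N ((q + 1)`_2^')%N.
have g_odd : odd g by apply: dvdn_odd (dvdn_gcdl _ _) (odd_part_odd _).
have g1 : (g %| q - 1)%N := dvdn_trans (dvdn_gcdl _ _) (dvdn_part _ _).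
have g2 : (g %| q + 1)%N := dvdn_trans (dvdn_gcdr _ _) (dvdn_part _ _).
have : (g %| 2)%N.
  by have := dvdn_sub g2 g1; rewrite (_ : q + 1 - (q - 1) = 2)%N //; lia.
move/(dvdn_leq (isT : 0 < 2)%N); rewrite /coprime -/g.
by case: (g) g_odd => [|[|[|k]]].
Qed.

Lemma card_Per_chebyshev2 (K : finFieldType) (p n : nat) :
  prime p -> #|K| = (p ^ n)%N ->
  (2 * #|Per (chebyshev_poly 2) K| = (#|K| - 1)`_2^' + (#|K| + 1)`_2^')%N.
Proof.
move=> p_prime cardK.
have [L [iota _]] := countable_algebraic_closure K.
have q_gt1 := finNzRing_gt1 K.
set q := #|K| in q_gt1 *.
have q0 : q%:R = 0 :> L.
  rewrite /q cardK natrX.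
  have := card_finPcharP cardK p_prime; rewrite -(fmorph_pchar iota) => pcharL.
  (* n = 0 would give a field with one element. *)
  rewrite pcharf0 // expr0n; case: n cardK => //= cardK.
  by rewrite /q cardK in q_gt1.
have dvd_q_neq0 (d e : nat) : (d %| e)%N -> e%:R != 0 :> L -> d%:R != 0 :> L.
  by move=> /dvdnP[k ->]; rewrite natrM; apply: contraNneq => ->; rewrite mulr0.
have qB1 : (q - 1)%:R = -1 :> L by rewrite natrB ?q0 ?sub0r // ltnW.
have qD1 : (q + 1)%:R = 1 :> L by rewrite natrD q0 add0r.
set a := ((q - 1)`_2^')%N; set b := ((q + 1)`_2^')%N.
(* In L, a and b divide -1 and 1 respectively, so X^a - 1 and X^b - 1 are separable. *)
have a0 : a%:R != 0 :> L.
  by apply: (dvd_q_neq0 _ _ (dvdn_part _ _)); rewrite qB1 oppr_eq0 oner_eq0.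
have b0 : b%:R != 0 :> L.
  by apply: (dvd_q_neq0 _ _ (dvdn_part _ _)); rewrite qD1 oner_eq0.
have [A [A_uniq A_size A_mem]] := roots_of_unity_seq a0.
have [B [B_uniq B_size B_mem]] := roots_of_unity_seq b0.
have a_odd : odd a := odd_part_odd _.
have b_odd : odd b := odd_part_odd _.
have in_K z : z \in A ++ B -> exists w, iota w = z + z^-1.
  rewrite mem_cat A_mem B_mem => /orP z_AB.
  have z0 : z != 0 by case: z_AB => /eqP ze; apply: expr_eq1_neq0 ze; apply: odd_gt0.
  apply/(addrV_in_field iota p_prime cardK z0).
  have expr1_dvd (d e : nat) : (d %| e)%N -> z ^+ d = 1 -> z ^+ e = 1.
    by move=> /dvdnP[k ->] zd; rewrite mulnC exprM zd expr1n.
  by case: z_AB => /eqP ze; [left|right]; apply: expr1_dvd ze; apply: dvdn_part.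
have fiber w :
    count (fun z => z + z^-1 == iota w) (A ++ B)
    = (2 * (w \in Per (chebyshev_poly 2) K))%N.
  have [w_per|w_nper] := boolP (w \in Per _ _); last first.
    rewrite muln0; apply/eqP; rewrite -leqn0 leqNgt -has_count.
    apply: contra w_nper => /hasP[z]; rewrite mem_cat A_mem B_mem => z_AB /eqP wz.
    apply/(Per_chebyshev2P iota w p_prime cardK); exists z; split=> //.
    by case/orP: z_AB => /eqP; [left|right].
  have [z [-> z_odd]] := (Per_chebyshev2P iota w p_prime cardK).1 w_per.
  have z0 : z != 0 by case: z_odd => ze; apply: expr_eq1_neq0 ze; apply: odd_gt0.
  rewrite count_cat muln1.
  (* If z = 1/z then z = 1, met once in [A] and once in [B]. *)
  have [z_inv|z_ninv] := eqVneq z z^-1.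
    have -> : z = 1 by case: z_odd => ze; apply: odd_expr_eq1_invr_eq1 ze z_inv.
    by rewrite (count_addrV_eq2 a_odd) ?(count_addrV_eq2 b_odd).
  rewrite (count_addrV_eq A_uniq A_mem) ?odd_gt0 //.
  rewrite (count_addrV_eq B_uniq B_mem) ?odd_gt0 //.
  (* An order dividing the coprime a and b is 1; so exactly one list supplies both z and 1/z. *)
  have not_both : ~~ ((z ^+ a == 1) && (z ^+ b == 1)).
    apply/negP => /andP[/eqP za /eqP zb].
    have [m zm m_a] := prim_order_exists (odd_gt0 a_odd) za.
    have m_b : (m %| b)%N by rewrite (prim_order_dvd zm) zb.
    have : (m %| gcdn a b)%N by rewrite dvdn_gcd m_a.
    rewrite (eqP (coprime_odd_part_pred_succ q_gt1)) (prim_order_dvd zm) expr1.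
    by move=> /eqP z1; rewrite z1 invr1 eqxx in z_ninv.
  have : (z ^+ a == 1) || (z ^+ b == 1).
    by case: z_odd => /eqP; rewrite -/q -/a -/b => ->; rewrite ?orbT.
  by case: (z ^+ a == 1) not_both; case: (z ^+ b == 1).
rewrite -A_size -B_size -size_cat -sum1_card big_mkcond big_distrr /=.
(* Each z lies above exactly one w of K; exchanging the sums then counts fibre by fibre. *)
have -> : size (A ++ B) = (\sum_(z <- A ++ B) \sum_w (z + z^-1 == iota w)%R)%N.
  rewrite -sum1_size big_seq [RHS]big_seq; apply: eq_bigr => z /in_K[w <-].
  rewrite (bigD1 w) //= eqxx big1 ?addn0 // => v v_w.
  by rewrite (inj_eq (fmorph_inj iota)) eq_sym (negbTE v_w).
rewrite exchange_big /=; apply: eq_bigr => w _.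
by rewrite -[RHS]big_mkcond sum1_count fiber; case: (w \in _).
Qed.

(** * 2-adic valuations of p^n - 1 and p^n + 1 *)

Lemma expn_gt1 (x k : nat) : (1 < x)%N -> (0 < k)%N -> (1 < x ^ k)%N.
Proof. by move=> x_gt1 k_gt0; apply: leq_ltn_trans (ltn_expl k x_gt1). Qed.

Lemma odd_sum_odd (k : nat) (f : 'I_k -> nat) :
  (forall i, odd (f i)) -> odd (\sum_(i < k) f i)%N = odd k.
Proof.
elim: k f => [|k IHk] f f_odd; first by rewrite big_ord0.
by rewrite big_ord_recr /= oddD f_odd IHk // addbT.
Qed.

Lemma logn2_odd (n : nat) : odd n -> logn 2 n = 0%N.
Proof. by move=> n_odd; rewrite lognE dvdn2 n_odd !andbF. Qed.

(** The cofactor of x - 1 in x^k - 1 is a sum of k odd terms, hence odd. *)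
Lemma logn2_expn_pred (x k : nat) : (1 < x)%N -> odd x -> odd k ->
  logn 2 (x ^ k - 1) = logn 2 (x - 1).
Proof.
move=> x_gt1 x_odd k_odd; rewrite -[X in (x ^ k - X)%N](exp1n k) subn_exp.
set S := (X in (_ * X)%N).
have S_odd : odd S.
  by rewrite /S odd_sum_odd // => i; rewrite oddM !oddX x_odd !orbT.
by rewrite lognM ?subn_gt0 ?odd_gt0 // (logn2_odd S_odd) addn0.
Qed.

Lemma logn_sqr_pred (p y : nat) : (1 < y)%N ->
  logn p (y ^ 2 - 1) = (logn p (y - 1) + logn p (y + 1))%N.
Proof.
move=> y_gt1; rewrite -[X in (y ^ 2 - X)%N](exp1n 2) subn_sqr.
by rewrite lognM ?subn_gt0 ?addn1.
Qed.

(** Apply the minus case to x^2, split both sides as differences of squares, and cancel the minus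
    factors. *)
Lemma logn2_expn_succ (x k : nat) : (1 < x)%N -> odd x -> odd k ->
  logn 2 (x ^ k + 1) = logn 2 (x + 1).
Proof.
move=> x_gt1 x_odd k_odd; have k_gt0 := odd_gt0 k_odd.
have xk_gt1 : (1 < x ^ k)%N by exact: expn_gt1.
have x2_gt1 : (1 < x ^ 2)%N by exact: expn_gt1.
have x2_odd : odd (x ^ 2) by rewrite oddX x_odd orbT.
have := logn2_expn_pred x2_gt1 x2_odd k_odd.
rewrite -expnM mulnC expnM !logn_sqr_pred // logn2_expn_pred // => /eqP.
by rewrite eqn_add2l => /eqP.
Qed.

(** An odd square is 1 mod 4. *)
Lemma logn2_sqr_succ (x : nat) : odd x -> logn 2 (x ^ 2 + 1) = 1%N.
Proof.
move=> x_odd; rewrite -(odd_double_half x) x_odd add1n -mul2n.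
have -> : ((2 * x./2).+1 ^ 2 + 1 = 2 * (2 * (x./2 ^ 2 + x./2)).+1)%N by nia.
by rewrite lognM // [X in (_ + X)%N]logn2_odd //= mul2n odd_double.
Qed.

(** Of two consecutive even numbers exactly one is 2 mod 4; the parity of [x./2] tells which. *)
Lemma logn2_pred_succ_odd (x : nat) : (1 < x)%N -> odd x ->
  let mu := maxn (logn 2 (x - 1)) (logn 2 (x + 1)) in
  (0 < mu)%N /\
  ((logn 2 (x - 1) = 1%N /\ logn 2 (x + 1) = mu) \/
   (logn 2 (x - 1) = mu /\ logn 2 (x + 1) = 1%N)).
Proof.
move=> x_gt1 x_odd.
have lognS : logn 2 (x - 1) = 1%N \/ logn 2 (x + 1) = 1%N.
  have := odd_double_half x; rewrite x_odd => xE.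
  case half_odd: (odd x./2); [left|right].
    have -> : (x - 1 = 2 * x./2)%N by rewrite -[in LHS]xE; lia.
    by rewrite lognM ?(odd_gt0 half_odd) // [X in (_ + X)%N]logn2_odd.
  have -> : (x + 1 = 2 * (x./2).+1)%N by rewrite -[in LHS]xE; lia.
  by rewrite lognM // [X in (_ + X)%N]logn2_odd //= half_odd.
have even_pos y : (0 < y)%N -> ~~ odd y -> (0 < logn 2 y)%N.
  by move=> y_gt0; rewrite -dvdn2 logn_gt0 mem_primes y_gt0.
have pos1 : (0 < logn 2 (x - 1))%N.
  by apply: even_pos; [rewrite subn_gt0 | rewrite oddB ?x_odd // ltnW].
have pos2 : (0 < logn 2 (x + 1))%N.
  by apply: even_pos; [rewrite addn1 | rewrite oddD x_odd].
split; first lia.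
by case: lognS => lognE1; [left|right]; rewrite lognE1; split=> //; lia.
Qed.

(** The odd part of n changes neither valuation. The first squaring of p adds the valuations of p -
    1 and p + 1, which are 1 and mu in some order; each later squaring adds 1, since an odd square
    plus one is 2 mod 4. *)
Lemma logn2_expn_pred_succ (p n : nat) : (1 < p)%N -> odd p -> (0 < n)%N ->
  let mu := maxn (logn 2 (p - 1)) (logn 2 (p + 1)) in
  (logn 2 (p ^ n - 1) = 1%N /\ logn 2 (p ^ n + 1) = (mu + logn 2 n)%N) \/
  (logn 2 (p ^ n - 1) = (mu + logn 2 n)%N /\ logn 2 (p ^ n + 1) = 1%N).
Proof.
move=> p_gt1 p_odd n_gt0 mu.
have [_ mu_case] := logn2_pred_succ_odd p_gt1 p_odd.
have [m] := pfactor_coprime (isT : prime 2) n_gt0.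
rewrite coprime2n => m_odd; case: (logn 2 n) => [|k] ->.
  by rewrite muln1 addn0 logn2_expn_pred // logn2_expn_succ.
right; rewrite mulnC expnM.
have pk_gt1 : (1 < p ^ (2 ^ k.+1))%N by rewrite expn_gt1 ?expn_gt0.
have pk_odd j : odd (p ^ (2 ^ j)) by rewrite oddX p_odd orbT.
rewrite (logn2_expn_pred pk_gt1) // (logn2_expn_succ pk_gt1) //.
rewrite (expnSr 2 k) expnM logn2_sqr_succ //.
split=> //; elim: k {pk_gt1} => [|k IHk].
  by rewrite expn1 logn_sqr_pred // /mu; lia.
have pk_gt1 : (1 < p ^ (2 ^ k.+1))%N by rewrite expn_gt1 ?expn_gt0.
rewrite logn_sqr_pred // (expnSr 2 k) expnM IHk logn2_sqr_succ //; lia.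
Qed.

(** * Error estimate and limit *)

Lemma natr_odd_part (R : realType) (n : nat) : (0 < n)%N ->
  ((n`_2^')%N%:R : R) = n%:R / (2 ^ logn 2 n)%:R.
Proof.
move=> n_gt0; rewrite -[in RHS](partnC 2%N n_gt0) p_part natrM.
rewrite lognM ?expn_gt0 ?part_gt0 // pfactorK // (logn2_odd (odd_part_odd n)).
by rewrite addn0 mulrC mulKf // pnatr_eq0 -lt0n expn_gt0.
Qed.

Lemma dist_card_Per_ratio_le (R : realType) (K : finFieldType) (p n : nat)
  (mu := maxn (logn 2 (p - 1)) (logn 2 (p + 1))) :
  prime p -> odd p -> (0 < n)%N -> #|K| = (p ^ n)%N ->
  `|(2 ^ (mu + logn 2 n - 1) + 1)%:R / (2 ^ (mu + logn 2 n + 1))%:R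
    - #|Per (chebyshev_poly 2) K|%:R / (p ^ n)%:R| <= (p ^ n)%:R^-1 :> R.
Proof.
move=> p_prime p_odd n_gt0 cardK.
have p_gt1 := prime_gt1 p_prime.
have [mu_gt0 _] := logn2_pred_succ_odd p_gt1 p_odd; rewrite -/mu in mu_gt0.
have q_gt1 : (1 < p ^ n)%N by exact: expn_gt1.
have Per2 := card_Per_chebyshev2 p_prime cardK.
set N := #|_| in Per2 *; have := congr1 (fun k => k%:R : R) Per2.
have q1_gt0 : (0 < p ^ n - 1)%N by rewrite subn_gt0.
have qD1_gt0 : (0 < p ^ n + 1)%N by rewrite addn1.
rewrite /= cardK natrM natrD (natr_odd_part _ q1_gt0) (natr_odd_part _ qD1_gt0).
rewrite natrB 1?ltnW // (natrD _ (p ^ n) 1).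
set P := N%:R; set q : R := (p ^ n)%:R.
have q0 : 0 < q :> R by rewrite ltr0n ltnW.
(* As mu > 0, the truncated subtraction in the exponent of the limit is exact; t is its value. *)
have [t mu_t] : exists t, (mu + logn 2 n = t.+1)%N.
  by exists (mu + logn 2 n).-1; rewrite prednK // addn_gt0 mu_gt0.
have := logn2_expn_pred_succ p_gt1 p_odd n_gt0; rewrite -/mu mu_t.
move=> logn_q PE.
rewrite subSS subn0 (addn1 t.+1) (natrD _ (2 ^ t) 1) (expnS 2 t.+1) (expnS 2 t) !natrM.
set T : R := (2 ^ t)%:R.
have T1 : 1 <= T :> R by rewrite ler1n expn_gt0.
have T0 : 0 < T := lt_le_trans ltr01 T1.
have T_neq0 := lt0r_neq0 T0; have q_neq0 := lt0r_neq0 q0.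
(* One odd part is (q - 1)/2 or (q + 1)/2, the other has the opposite sign and denominator 2T. So 2P
   differs from q/2 + q/(2T) by 1/2 - 1/(2T) up to sign, and halving gives c. *)
have [c c1 PE'] : exists2 c : R, `|c| <= 1 &
    (T + 1) / (2 * (2 * T)) - P / q = c / q.
  have c_le : 0 <= (T - 1) / (4 * T) <= 1.
    by rewrite divr_ge0 ?ler_pdivrMr //; lra.
  case: logn_q PE => -[-> ->]; rewrite expn1 mu_t (expnS 2 t) natrM -/T => PE.
    exists ((T - 1) / (4 * T)); first by rewrite ger0_norm; lra.
    by have -> : P = 2 * P / 2; [field | rewrite PE; field; rewrite ?T_neq0 ?q_neq0].
  exists (- ((T - 1) / (4 * T))); first by rewrite normrN ger0_norm; lra.
  by have -> : P = 2 * P / 2; [field | rewrite PE; field; rewrite ?T_neq0 ?q_neq0].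
by rewrite PE' normrM normfV (gtr0_norm q0) ler_piMl // invr_ge0 ltW.
Qed.

Theorem theorem5p6 (R : realType) (p : nat) (p_prime : prime p)
  (p_odd : odd p) (F : nat -> finFieldType)
  (card_F : forall n : nat, (0 < n)%N -> #|F n| = (p ^ n)%N) (nu : nat) :
  let mu := maxn (logn 2 (p - 1)) (logn 2 (p + 1)) in
  (#|Per (chebyshev_poly 2) (F n)|%:R / (p ^ n)%:R : R)
    @[n --> within [set n : nat | (0 < n)%N /\ logn 2 n = nu] \oo]
  --> ((2 ^ (mu + nu - 1) + 1)%:R / (2 ^ (mu + nu + 1))%:R : R).
Proof.
move=> mu; apply/cvgrPdist_le => e e_gt0.
rewrite near_withinE; near=> n => /= -[n_gt0 n_nu]; rewrite -n_nu.
apply: le_trans (dist_card_Per_ratio_le R p_prime p_odd n_gt0 (card_F _ n_gt0)) _.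
(* Since n + 1 <= p^n, the error p^(-n) is at most 1/(n + 1), which is eventually below e. *)
have e_n : n.+1%:R^-1 < e by near: n; exact: (near_infty_natSinv_lt (PosNum e_gt0)).
apply: le_trans (ltW e_n).
have n_lt : (n < p ^ n)%N by apply: ltn_expl; apply: prime_gt1.
have pn_gt0 : (0 < p ^ n)%N := leq_ltn_trans (leq0n n) n_lt.
by rewrite lef_pV2 ?posrE ?ltr0n // ler_nat.
Unshelve. all: by end_near.
Qed.
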